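(* Let $\mathcal{T}$ be a non-empty finite collection of tasks $\iota=(A_\iota,B_\iota)$, each a pair of non-empty disjoint sets of free degrees of freedom with $X_\iota=C[A_\iota,A_\iota]$ invertible. Let $P=\bigcup_\iota(A_\iota\cup B_\iota)$, $p=|P|$, $C_P=C[P,P]$, and let $\mathbf{D}_{\mathcal{T}}=(D_{B_\iota\leftarrow A_\iota})_{\iota\in\mathcal{T}}$ be the tuple of the transmissions $D_{B_\iota\leftarrow A_\iota}=C[B_\iota,A_\iota]X_\iota^{-1}$, with $n_{\mathcal{T}}=\sum_\iota|B_\iota||A_\iota|$ entries. Whenever $C=C^{T}$, $$\operatorname{rank}\frac{\partial\mathbf{D}_{\mathcal{T}}}{\partial k}\le\min\Bigl(n_b,\ \tfrac12p(p+1)-1\Bigr).$$ If moreover $a\equiv0$, so that $K_{ff}=\sum_bk_bq_bq_b^{T}$ on the free degrees of freedom, then $$\operatorname{rank}\frac{\partial\mathbf{D}_{\mathcal{T}}}{\partial k}\le\operatorname{rank}\frac{\partial C_P}{\partial k}-1\le\min\Bigl(n_b,\ \tfrac12p(p+1)\Bigr)-1.$$ Without symmetry, the Jacobian with respect to $(k,a)$ satisfies $\operatorname{rank}\,\partial\mathbf{D}_{\mathcal{T}}/\partial(k,a)\le\min\bigl(2n_b-1,\ p(p-1)\bigr)$.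
   Context: Network: $N$ point nodes at positions $x_i\in\mathbb{R}^2$ are joined by $n_b$ bonds. For a bond $b=(i,j)$ of length $L_b=|x_j-x_i|>0$ let $\hat n_b=(x_j-x_i)/L_b$ and let $\hat t_b$ be $\hat n_b$ rotated by $+90^\circ$. The vector $q_b\in\mathbb{R}^{2N}$ carries $-\hat n_b$ at node $i$, $+\hat n_b$ at node $j$, zeros elsewhere; $s_b$ is the same with $\hat t_b$. For stiffnesses $k=(k_b)$, $k_b>0$, and odd couplings $a=(a_b)\in\mathbb{R}^{n_b}$, $K=\sum_b(k_bq_b+a_bs_b)q_b^{T}$. Three degrees of freedom are pinned to remove the planar rigid-body modes, $K_{ff}$ is the restriction of $K$ to the remaining $n_{\mathrm{free}}=2N-3$ free ones, assumed invertible, and $C=K_{ff}^{-1}$. Derivatives in $k$ are taken at fixed $a$. $D_{B\leftarrow A}$ is the matrix of displacements read on $B$ when a displacement pattern is prescribed on $A$ and all other free degrees of freedom equilibrate; it equals $C[B,A]\,C[A,A]^{-1}$. *)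

(* Defs.v *)
From HB Require Import structures.
From mathcomp Require Import all_boot all_order all_algebra.
From mathcomp Require Import all_classical all_reals all_analysis.

Set Implicit Arguments.
Unset Strict Implicit.
Unset Printing Implicit Defensive.

Import Order.TTheory GRing.Theory Num.Theory.
Import numFieldNormedType.Exports.

Local Open Scope ring_scope.

(* Row i of x : 'M[R]_(N, 2) is the position of node i.  The 2N degrees of
   freedom are indexed by 'I_(N * 2): coordinate c of node i is
   [mxvec_index i c], so that a displacement field u : 'M[R]_(N, 2) is
   flattened by [mxvec]. *)

Section Bonds.
Variables (R : realType) (N : nat) (x : 'M[R]_(N, 2)).

(* The norm `|_| of 'rV[R]_2 is the sup norm, hence the explicit Euclidean
   length. *)
Definition bond_length (e : 'I_N * 'I_N) : R :=
  Num.sqrt (\sum_c (x e.2 c - x e.1 c) ^+ 2).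

Definition bond_normal (e : 'I_N * 'I_N) : 'rV[R]_2 :=
  (bond_length e)^-1 *: (row e.2 x - row e.1 x).

(* Rotation by +90 degrees: (v_0, v_1) |-> (- v_1, v_0). *)
Definition rot90 (v : 'rV[R]_2) : 'rV[R]_2 :=
  \row_c (if c == 0 then - v 0 1 else v 0 0).

Definition bond_tangent (e : 'I_N * 'I_N) : 'rV[R]_2 := rot90 (bond_normal e).

(* - w at node e.1, + w at node e.2, zero elsewhere. *)
Definition bond_vector (e : 'I_N * 'I_N) (w : 'rV[R]_2) : 'cV[R]_(N * 2) :=
  (mxvec (\matrix_(i, c)
     (if i == e.1 then - w 0 c else if i == e.2 then w 0 c else 0)))^T.

Definition q_vec (e : 'I_N * 'I_N) := bond_vector e (bond_normal e).
Definition s_vec (e : 'I_N * 'I_N) := bond_vector e (bond_tangent e).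

(* Infinitesimal translation v plus infinitesimal rotation of rate w. *)
Definition rigid_mode (v : 'rV[R]_2) (w : R) : 'rV[R]_(N * 2) :=
  mxvec (\matrix_(i < N) (v + w *: rot90 (row i x))).

Definition pins_rigid_modes (pinned : {set 'I_(N * 2)}) : Prop :=
  forall (v : 'rV[R]_2) (w : R),
    (forall d, d \in pinned -> rigid_mode v w 0 d = 0) -> v = 0 /\ w = 0.

End Bonds.

(* M[B, A], with the elements of B and A listed in increasing order. *)
Definition subset_mx (R : Type) (m n : nat) (M : 'M[R]_(m, n))
    (B : {set 'I_m}) (A : {set 'I_n}) : 'M[R]_(#|B|, #|A|) :=
  mxsub (fun i : 'I_#|B| => enum_val i) (fun j : 'I_#|A| => enum_val j) M.

Section Stiffness.
Variables (R : realType) (N nb : nat) (x : 'M[R]_(N, 2)).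
Variables (bond : 'I_nb -> 'I_N * 'I_N) (pinned : {set 'I_(N * 2)}).

Definition stiffness (k a : 'rV[R]_nb) : 'M[R]_(N * 2) :=
  \sum_b (k 0 b *: q_vec x (bond b) + a 0 b *: s_vec x (bond b))
         *m (q_vec x (bond b))^T.

(* The free degrees of freedom are renumbered by 'I_#|~: pinned|. *)
Definition stiffness_ff (k a : 'rV[R]_nb) : 'M[R]_#|~: pinned| :=
  subset_mx (stiffness k a) (~: pinned) (~: pinned).

Definition compliance (k a : 'rV[R]_nb) : 'M[R]_#|~: pinned| :=
  invmx (stiffness_ff k a).

End Stiffness.

Definition transmission (R : realType) (n : nat) (C : 'M[R]_n)
    (A B : {set 'I_n}) : 'M[R]_(#|B|, #|A|) :=
  subset_mx C B A *m invmx (subset_mx C A A).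

(* The tuple of the transmissions of a family of tasks, each matrix being
   flattened and the results concatenated. *)
Definition transmissions (R : realType) (n m : nat) (C : 'M[R]_n)
    (A B : 'I_m -> {set 'I_n}) : 'rV[R]_(\sum_i #|B i| * #|A i|) :=
  \mxrow_i mxvec (transmission C (A i) (B i)).

(* If the forces K u balancing a displacement u act on A only, that is, if u is
   prescribed on A and all other degrees of freedom equilibrate, then u|_B is
   the image of u|_A under [transmission]. *)
Lemma transmissionE (R : realType) (n : nat) (K : 'M[R]_n)
    (A B : {set 'I_n}) (u : 'cV[R]_n) :
  K \in unitmx -> subset_mx (invmx K) A A \in unitmx ->
  (forall i, i \notin A -> (K *m u) i 0 = 0) ->
  rowsub (fun i : 'I_#|B| => enum_val i) u =
  transmission (invmx K) A B *m rowsub (fun i : 'I_#|A| => enum_val i) u.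
Proof.
move=> uK uX eqf; set f := K *m u.
have uE : u = invmx K *m f by rewrite mulKmx.
have restr (D : {set 'I_n}) : rowsub (fun i : 'I_#|D| => enum_val i) u =
    subset_mx (invmx K) D A *m rowsub (fun i : 'I_#|A| => enum_val i) f.
  apply/matrixP => i j; rewrite ord1 {1}uE mxE [LHS]mxE [RHS]mxE.
  transitivity (\sum_(l in A) invmx K (enum_val i) l * f l 0); last first.
    by rewrite big_enum_val; apply: eq_bigr => l _; rewrite !mxE.
  rewrite (bigID (mem A)) /= [X in _ + X]big1 ?addr0// => l lA.
  by rewrite /f eqf// mulr0.
by rewrite !restr /transmission -mulmxA mulKmx.
Qed.

(* Main.v *)
(* The transmissions D are a function G of C_P, so J_D = J_(C_P) J_G, and the
   bounds count directions killed by dG.  G is invariant under rescaling of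
   C_P, so dG kills C_P itself.  When C is symmetric it stays so as k varies,
   and the image of dC_P lies in the space of symmetric matrices, which
   contains C_P.  If a = 0, C is homogeneous of degree -1 in k, so by Euler
   dC_P maps k to - C_P, a nonzero element of the kernel of dG.  In general
   the same holds for (k, a), and G is invariant under rescaling each column
   of C_P separately, which gives p independent directions in the kernel of
   dG. *)

Require Import Defs.
From HB Require Import structures.
From mathcomp Require Import all_boot all_order all_algebra.
From mathcomp Require Import all_classical all_reals all_analysis.

Import Order.TTheory GRing.Theory Num.Theory.
Import numFieldNormedType.Exports.

Local Open Scope ring_scope.

Set Implicit Arguments.
Unset Strict Implicit.
Unset Printing Implicit Defensive.

(** * Differentiability of matrix-valued maps *)

Section Differentiability.
Context {R : realType} {V : normedModType R}.
Local Open Scope classical_set_scope.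

(** Differentiability depends only on the germ at [x]: the first-order expansion of [f] is also one
    of [g], and uniqueness of the linear part makes it ['d g x]. *)
Lemma near_eq_differentiable (W : normedModType R) (f g : V -> W) (x : V) :
  (\near x, f x = g x) -> differentiable f x -> differentiable g x.
Proof.
move=> fg /diff_locallyP[dfc dfx].
suff E : g \o shift x = cst (g x) + 'd f x +o_ 0 id.
  by apply/diff_locallyP; rewrite (diff_unique dfc E).
apply/eqaddoP => e e0; move/eqaddoP/(_ e e0) : dfx => dfx.
have gf : \forall h \near 0, f (h + x) = g (h + x).
  by move: fg; rewrite (near_shift 0); apply: filterS => h /=; rewrite subr0.
apply: filterS2 gf dfx => h fgh.
by rewrite !fctE /= -fgh -(nbhs_singleton fg).
Qed.

Lemma differentiable_fct_sum (I : Type) (r : seq I) (P : pred I)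
    (W : normedModType R) (f : I -> V -> W) (x : V) :
  (forall i, differentiable (f i) x) ->
  differentiable (fun y => \sum_(i <- r | P i) f i y) x.
Proof.
move=> df; rewrite -fct_sumE; elim/big_ind: _ => // g h dg dh.
exact: differentiableD dg dh.
Qed.

Lemma differentiable_fct_prod (I : Type) (r : seq I) (P : pred I)
    (f : I -> V -> R) (x : V) :
  (forall i, differentiable (f i) x) ->
  differentiable (fun y => \prod_(i <- r | P i) f i y) x.
Proof.
move=> df; rewrite -fct_prodE; elim/big_ind: _ => // g h dg dh.
exact: differentiableM dg dh.
Qed.

Lemma differentiable_mxP (m n : nat) (M : V -> 'M[R]_(m, n)) (x : V) :
  differentiable M x <-> forall i j, differentiable (fun y => M y i j) x.
Proof.
split=> [dM i j|dM].
  apply: (@differentiable_comp _ _ _ _ M (fun A : 'M[R]_(m, n) => A i j)) => //.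
  exact: differentiable_coord.
rewrite (_ : M = fun y => \sum_i \sum_j M y i j *: delta_mx i j); last first.
  by apply/funext => y; exact: matrix_sum_delta.
do 2! apply: differentiable_fct_sum => ?; exact: differentiableZl.
Qed.

Lemma differentiable_mulmx (m n p : nat) (M : V -> 'M[R]_(m, n))
    (N : V -> 'M[R]_(n, p)) (x : V) :
  differentiable M x -> differentiable N x ->
  differentiable (fun y => M y *m N y) x.
Proof.
move=> /differentiable_mxP dM /differentiable_mxP dN.
apply/differentiable_mxP => i j.
under eq_fun do rewrite mxE.
by apply: differentiable_fct_sum => l; apply: differentiableM.
Qed.

Lemma differentiable_det (n : nat) (M : V -> 'M[R]_n) (x : V) :
  differentiable M x -> differentiable (fun y => \det (M y)) x.
Proof.
move=> /differentiable_mxP dM.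
apply: differentiable_fct_sum => s; apply: differentiableM.
  exact: differentiable_cst.
exact: differentiable_fct_prod.
Qed.

Lemma differentiable_mxsub (m n p q : nat) (f : 'I_p -> 'I_m) (g : 'I_q -> 'I_n)
    (M : V -> 'M[R]_(m, n)) (x : V) :
  differentiable M x -> differentiable (fun y => mxsub f g (M y)) x.
Proof.
move=> /differentiable_mxP dM; apply/differentiable_mxP => i j.
by under eq_fun do rewrite mxE.
Qed.

Lemma differentiable_mxvec (m n : nat) (M : V -> 'M[R]_(m, n)) (x : V) :
  differentiable M x -> differentiable (fun y => mxvec (M y)) x.
Proof.
move=> /differentiable_mxP dM; apply/differentiable_mxP => i j.
rewrite (ord1 i); case/mxvec_indexP: j => j l.
by under eq_fun do rewrite mxvecE.
Qed.

Lemma differentiable_vec_mx (m n : nat) (v : V -> 'rV[R]_(m * n)) (x : V) :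
  differentiable v x -> differentiable (fun y => vec_mx (v y)) x.
Proof.
move=> /differentiable_mxP dv; apply/differentiable_mxP => i j.
by under eq_fun do rewrite mxE.
Qed.

(** [invmx] returns singular matrices unchanged, so the cofactor formula is used only near [x],
    where the determinant stays nonzero by continuity. *)
Lemma differentiable_invmx (n : nat) (M : V -> 'M[R]_n) (x : V) :
  differentiable M x -> M x \in unitmx ->
  differentiable (fun y => invmx (M y)) x.
Proof.
move=> dM; rewrite unitmxE unitfE => M0; have ddet := differentiable_det dM.
apply: (@near_eq_differentiable _ (fun y => (\det (M y))^-1 *: \adj (M y))).
  have : \forall y \near x, \det (M y) != 0.
    exact: cvgr_neq0 (differentiable_continuous ddet) M0.
  by apply: filterS => y My0; rewrite /invmx unitmxE unitfE My0.
move/differentiable_mxP: (dM) => dMij; apply/differentiable_mxP => i j.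
under eq_fun do rewrite !mxE.
apply: differentiableM; first exact: differentiableV.
apply: differentiableM; first exact: differentiable_cst.
apply: differentiable_det; apply/differentiable_mxP => k l.
by under eq_fun do rewrite !mxE.
Qed.

(** Turns an invariance under a one-parameter rescaling, valid for small [t], into a kernel vector
    of the differential. *)
Lemma diff_near_cst (W : normedModType R) (f : V -> W) (x v : V) :
  differentiable f x -> (\forall t \near (0 : R), f (x + t *: v) = f x) ->
  'd f x v = 0.
Proof.
move=> df fx; rewrite -deriveE// /derive; apply: cvg_lim => //.
apply: (@cvg_trans _ ((fun=> 0 : W) @ (0 : R)^')); last exact: cvg_cst.
apply: near_eq_cvg; apply: cvg_within; move: fx; apply: filterS => t /= E.
by rewrite [_ + x]addrC E subrr scaler0.
Qed.

End Differentiability.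

(** Jacobians act on row vectors from the right, so the inner map comes first in the product. *)
Lemma jacobian_comp (R : realType) (m n p : nat) (f : 'rV[R]_m -> 'rV[R]_n)
    (g : 'rV[R]_n -> 'rV[R]_p) (x : 'rV[R]_m) :
  differentiable f x -> differentiable g (f x) ->
  'J (g \o f) x = 'J f x *m 'J g (f x).
Proof.
move=> df dg; apply/row_matrixP => i.
by rewrite !rowE mulmxA !mul_rV_lin1/= diff_comp.
Qed.

(** * Entries read by the transmissions, and invariance under column rescaling *)

Section Transmissions.
Context {R : realType} {n m : nat}.
Variables A B : 'I_m -> {set 'I_n}.

Lemma eq_transmissions (M M' : 'M[R]_n) :
  (forall l i j, i \in A l :|: B l -> j \in A l -> M' i j = M i j) ->
  transmissions M' A B = transmissions M A B.
Proof.
move=> eM; apply: eq_mxrow => l; congr mxvec; rewrite /transmission.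
congr (_ *m invmx _); apply/matrixP => i j; rewrite !mxE; apply: (eM l);
  by rewrite ?finset.in_setU ?(enum_valP i) ?(enum_valP j) ?orbT.
Qed.

(** With [D] the diagonal matrix of the factors on A, (C[B,A] D)(C[A,A] D)^-1 = C[B,A] C[A,A]^-1. *)
Lemma transmissions_col_scale (M M' : 'M[R]_n) (d : 'I_n -> R) :
  (forall l, subset_mx M (A l) (A l) \in unitmx) ->
  (forall j, d j != 0) ->
  (forall l i j, i \in A l :|: B l -> j \in A l -> M' i j = M i j * d j) ->
  transmissions M' A B = transmissions M A B.
Proof.
move=> uM d0 eM; apply: eq_mxrow => l; congr mxvec; rewrite /transmission.
pose D := diag_mx (\row_j d (enum_val j : 'I_n)) : 'M[R]_#|A l|.
have eD (E : {set 'I_n}) : (forall i, i \in E -> i \in A l :|: B l) ->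
    subset_mx M' E (A l) = subset_mx M E (A l) *m D.
  move=> EAB; apply/matrixP => i j.
  by rewrite mul_mx_diag !mxE (eM l) ?EAB ?enum_valP.
have uD : D \in unitmx.
  rewrite unitmxE det_diag unitfE; apply/prodf_neq0 => j _.
  by rewrite mxE.
rewrite !eD; try by move=> i; rewrite finset.in_setU => ->; rewrite ?orbT.
have uMD : subset_mx M (A l) (A l) *m D \in unitmx by rewrite unitmx_mul uM uD.
by rewrite -{1}[subset_mx M (B l) _](mulmxKV (uM l)) -(mulmxA _ _ D) mulmxK.
Qed.

(** A zero column would put a basis vector in the kernel of the invertible block. *)
Lemma unit_subset_mx_col_neq0 (M : 'M[R]_n) (l : 'I_m) (j : 'I_n) :
  subset_mx M (A l) (A l) \in unitmx -> j \in A l ->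
  exists2 i, i \in A l & M i j != 0.
Proof.
move=> uM jA; apply/exists_inP; apply: contraT => /exists_inPn M0.
pose e := delta_mx (enum_rank_in jA j) 0 : 'cV[R]_#|A l|.
have Me : subset_mx M (A l) (A l) *m e = 0.
  apply/matrixP => i k; rewrite -colE !mxE enum_rankK_in//.
  by apply/eqP; move: (M0 (enum_val i) (enum_valP i)); rewrite negbK.
have : e = 0 by rewrite -[e](mulKmx uM) Me mulmx0.
move/matrixP/(_ (enum_rank_in jA j) 0); rewrite !mxE !eqxx => /eqP.
by rewrite oner_eq0.
Qed.

End Transmissions.

(** * Extension by zero of a matrix indexed by P *)

Section Extension.
Context {R : realType} {n : nat}.
Variable P : {set 'I_n}.

Definition subset_inj : 'M[R]_(#|P|, n) :=
  rowsub (fun i : 'I_#|P| => enum_val i) 1%:M.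

(** Written as a product with constant matrices, so that linearity and differentiability in [M] come
    from those of [*m]. *)
Definition extend_mx (M : 'M[R]_#|P|) : 'M[R]_n :=
  subset_inj^T *m M *m subset_inj.

Lemma subset_injE (i : 'I_#|P|) (j : 'I_n) :
  subset_inj i j = (enum_val i == j)%:R.
Proof. by rewrite !mxE. Qed.

Lemma extend_mxE (M : 'M[R]_#|P|) (i j : 'I_#|P|) :
  extend_mx M (enum_val i) (enum_val j) = M i j.
Proof.
rewrite !mxE (bigD1 j)//= subset_injE eqxx mulr1 big1 ?addr0; last first.
  by move=> k kj; rewrite subset_injE (inj_eq enum_val_inj) (negPf kj) mulr0.
rewrite mxE (bigD1 i)//= mxE subset_injE eqxx mul1r big1 ?addr0// => k ki.
by rewrite mxE subset_injE (inj_eq enum_val_inj) (negPf ki) mul0r.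
Qed.

Lemma extend_subset_mx (M : 'M[R]_n) (i j : 'I_n) :
  i \in P -> j \in P -> extend_mx (subset_mx M P P) i j = M i j.
Proof.
move=> iP jP; rewrite -{1}(enum_rankK_in iP iP) -{1}(enum_rankK_in jP jP).
by rewrite extend_mxE mxE !enum_rankK_in.
Qed.

End Extension.

(** * Rank bounds from kernel vectors and from symmetry *)

Section RankBounds.
Context {F : fieldType}.

(** Rank-nullity on the row space of [M]: its intersection with the kernel of [N] contains [v], so
    has dimension at least 1. *)
Lemma mxrank_mulmx_le (m n p : nat) (M : 'M[F]_(m, n)) (N : 'M[F]_(n, p))
    (v : 'rV_n) :
  v != 0 -> (v <= M)%MS -> v *m N = 0 -> (\rank (M *m N) + 1 <= \rank M)%N.
Proof.
move=> v0 vM vN; rewrite -(mxrank_mul_ker M N) leq_add2l lt0n mxrank_eq0.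
apply: contra_neq v0 => K0; apply/eqP; rewrite -submx0 -K0.
by rewrite sub_capmx vM; apply/sub_kermxP.
Qed.

(** The usual spanning family of the symmetric matrices, E_ii and E_ij + E_ji for i < j, flattened
    into rows. *)
Definition sym_basis (p : nat) :
    'M[F]_(#|[set ij : 'I_p * 'I_p | (ij.1 <= ij.2)%N]|, p * p) :=
  \matrix_t let ij := enum_val t in
    mxvec (if ij.1 == ij.2 then delta_mx ij.1 ij.2
           else delta_mx ij.1 ij.2 + delta_mx ij.2 ij.1).

Lemma card_le_pairs (p : nat) :
  #|[set ij : 'I_p * 'I_p | (ij.1 <= ij.2)%N]| = ((p * (p + 1)) %/ 2)%N.
Proof.
transitivity (\sum_(j < p) \sum_(i < p | (i <= j)%N) 1)%N.
  rewrite -sum1_card (reindex_inj (inv_inj (@swap_pairK _ _)))/=.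
  by rewrite pair_big_dep/=; apply: eq_bigl => -[i j]; rewrite inE.
under eq_bigr => j _.
  rewrite -(big_ord_widen p (fun=> 1%N) (ltn_ord j)) sum1_card card_ord.
  over.
(* The sum of j + 1 over j < p is the sum of all i < p + 1, whose term i = 0 vanishes. *)
have := bin2_sum p.+1; rewrite big_nat_recl// add0n big_mkord => ->.
by rewrite bin2 /= addn1 mulnC divn2.
Qed.

Lemma sym_basisP (p : nat) (M : 'M[F]_p) :
  M^T = M -> (mxvec M <= sym_basis p)%MS.
Proof.
move=> symM.
have -> : M = \sum_(ij : 'I_p * 'I_p | (ij.1 <= ij.2)%N)
    M ij.1 ij.2 *: (if ij.1 == ij.2 then delta_mx ij.1 ij.2
           else delta_mx ij.1 ij.2 + delta_mx ij.2 ij.1).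
  apply/matrixP => i j; rewrite summxE.
  (* Both sides are symmetric, so comparing entries with i <= j suffices; there only the term
     indexed by (i, j) contributes. *)
  wlog ij : i j / (i <= j)%N => [th|].
    case/orP: (leq_total i j) => [/th//|/th].
    rewrite -{1}symM mxE => ->; apply: eq_bigr => kl _; rewrite !mxE.
    congr (_ * _); case: ifP => [/eqP->|_]; rewrite !mxE.
      by rewrite andbC.
    by rewrite addrC ![(j == _) && _]andbC.
  rewrite (bigD1 (i, j))//= big1 ?addr0 => [|[k l]/= /andP[kl nij]].
    case: ifP => [/eqP->|nij]; rewrite !mxE !eqxx ?mulr1//.
    by rewrite nij /= addr0 mulr1.
  rewrite mxE; case: ifP => [/eqP E|_]; rewrite !mxE.
    rewrite [in LHS]E; case: eqP => [Ei|]; rewrite ?mulr0//=.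
    case: eqP => [Ej|]; rewrite ?mulr0//=.
    by move: nij; rewrite Ei Ej E eqxx.
  have -> : (i == k) && (j == l) = false.
    by apply: contraNF nij => /andP[/eqP-> /eqP->].
  have -> : (i == l) && (j == k) = false.
    (* Here k <= l = i <= j = k, so the two pairs would coincide. *)
    apply: contraNF nij => /andP[/eqP El /eqP Ek]; subst i j.
    by have/val_inj -> : k = l :> nat by apply/eqP; rewrite eqn_leq kl ij.
  by rewrite addr0 mulr0.
rewrite raddf_sum summx_sub// => -[i j] /= ij; rewrite linearZ /= scalemx_sub//.
have ijS : (i, j) \in [set ij : 'I_p * 'I_p | (ij.1 <= ij.2)%N] by rewrite inE.
rewrite (_ : mxvec _ = row (enum_rank_in ijS (i, j)) (sym_basis p)) ?row_sub//.
by rewrite rowK /= enum_rankK_in.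
Qed.

(** [M] may lie outside the row space of [J], so [J] is first enlarged to the space of all symmetric
    matrices, which contains [M] and loses a dimension under [L]. *)
Lemma mxrank_mulmx_sym (m p q : nat) (J : 'M[F]_(m, p * p))
    (L : 'M[F]_(p * p, q)) (M : 'M[F]_p) :
  (forall i, (vec_mx (row i J))^T = vec_mx (row i J)) ->
  M != 0 -> M^T = M -> mxvec M *m L = 0 ->
  (\rank (J *m L) <= (p * (p + 1)) %/ 2 - 1)%N.
Proof.
move=> symJ M0 symM ML.
have JS : (J <= sym_basis p)%MS.
  by apply/row_subP => i; rewrite -[row i J]vec_mxK sym_basisP.
apply: leq_trans (mxrankS (submxMr L JS)) _.
have M0' : mxvec M != 0 by rewrite mxvec_eq0.
have lt : (\rank (sym_basis p *m L) < (p * (p + 1)) %/ 2)%N.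
  rewrite -card_le_pairs -addn1.
  apply: leq_trans (mxrank_mulmx_le M0' (sym_basisP symM) ML) _.
  exact: rank_leq_row.
(* The strict inequality makes p(p+1)/2 positive, so the truncated subtraction is exact. *)
by rewrite subn1 -ltnS (ltn_predK lt).
Qed.

Lemma mxrank_sym (m p : nat) (J : 'M[F]_(m, p * p)) :
  (forall i, (vec_mx (row i J))^T = vec_mx (row i J)) ->
  (\rank J <= (p * (p + 1)) %/ 2)%N.
Proof.
move=> symJ; rewrite -card_le_pairs.
apply: leq_trans (rank_leq_row (sym_basis p)); apply/mxrankS/row_subP => i.
by rewrite -[row i J]vec_mxK sym_basisP.
Qed.

(** The p kernel vectors are nonzero and supported on distinct columns, hence independent: the rank
    is at most p^2 - p. *)
Lemma mxrank_col_kernel (p q : nat) (L : 'M[F]_(p * p, q))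
    (v : 'I_p -> 'cV[F]_p) :
  (forall j, v j != 0) ->
  (forall j, mxvec (v j *m delta_mx 0 j) *m L = 0) ->
  (\rank L <= p * (p - 1))%N.
Proof.
move=> v0 vL; pose V := \matrix_j mxvec (v j *m delta_mx (0 : 'I_1) j).
have VL : (V <= kermx L)%MS.
  by apply/sub_kermxP/row_matrixP => j; rewrite row_mul rowK vL row0.
have : row_free V.
  apply: inj_row_free => u uV; apply/rowP => j; rewrite mxE.
  (* At entry (i, j) the combination reduces to [u 0 j] times the nonzero entry i of [v j]. *)
  have /matrix0Pn[i [k vij]] := v0 j; rewrite (ord1 k) in vij.
  apply: (mulIf vij); rewrite mul0r.
  have : \sum_l u 0 l *: (v l *m delta_mx 0 l) = 0.
    apply: (can_inj mxvecK); rewrite linear0 -[RHS]uV.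
    rewrite mulmx_sum_row raddf_sum /=.
    by apply: eq_bigr => l _; rewrite linearZ /= rowK.
  move/matrixP/(_ i j); rewrite summxE (bigD1 j)//= big1 => [|l lj].
    by rewrite !mxE big_ord1 !mxE !eqxx mulr1 addr0.
  by rewrite !mxE big_ord1 !mxE [j == l]eq_sym (negPf lj) andbF !mulr0.
rewrite /row_free => /eqP rV; have := mxrankS VL; rewrite rV mxrank_ker.
have := rank_leq_row L; rewrite mulnBr muln1 => Lp pL.
by rewrite -(subKn Lp) leq_sub2l.
Qed.

End RankBounds.

Lemma near0_add1_neq0 (R : realType) : \forall t \near (0 : R), 1 + t != 0.
Proof.
apply: filterS (nbhs0_lt ltr01) => t; apply: contraTneq => /eqP.
by rewrite addrC addr_eq0 => /eqP->; rewrite normrN1 ltxx.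
Qed.

(** * The transmissions as a function of C_P, and the kernel of their differential *)

Section TransmissionRank.
Context {R : realType} {n m : nat}.
Variables A B : 'I_m -> {set 'I_n}.

Let P := (\bigcup_l (A l :|: B l))%SET.
Let p := #|P|.

Let task_sub (l : 'I_m) (i : 'I_n) : i \in A l :|: B l -> i \in P.
Proof. by move=> ilP; apply/bigcupP; exists l. Qed.

Let input_sub (l : 'I_m) (i : 'I_n) : i \in A l -> i \in P.
Proof. by move=> iA; apply: (@task_sub l); rewrite finset.in_setU iA. Qed.

(* The transmissions as a function of mxvec C_P: the compliance is extended by
   zero outside P x P, where the transmissions do not read it. *)
Definition transmissions_of (c : 'rV[R]_(p * p)) :=
  transmissions (extend_mx (vec_mx c)) A B.

Lemma transmissions_ofE (M : 'M[R]_n) :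
  transmissions_of (mxvec (subset_mx M P P)) = transmissions M A B.
Proof.
apply: eq_transmissions => l i j /task_sub iP /input_sub jP.
by rewrite mxvecK extend_subset_mx.
Qed.

Lemma differentiable_transmissions (V : normedModType R) (M : V -> 'M[R]_n)
    (x : V) :
  differentiable M x -> (forall l, subset_mx (M x) (A l) (A l) \in unitmx) ->
  differentiable (fun y => transmissions (M y) A B) x.
Proof.
move=> dM uM; apply/differentiable_mxP => i j; rewrite (ord1 i).
under eq_fun do rewrite mxE.
(* The task to which coordinate [j] of the concatenated row belongs. *)
pose l := tagnat.sig1 j.
suff: differentiable (fun y => mxvec (transmission (M y) (A l) (B l))) x.
  by move/differentiable_mxP.
apply: differentiable_mxvec; apply: differentiable_mulmx.
  exact: differentiable_mxsub.
by apply: differentiable_invmx => //; exact: differentiable_mxsub.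
Qed.

Variable M : 'M[R]_n.
Hypothesis uM : forall l, subset_mx M (A l) (A l) \in unitmx.

Let c0 := mxvec (subset_mx M P P).

Let uM0 l : subset_mx (extend_mx (vec_mx c0)) (A l) (A l) \in unitmx.
Proof.
rewrite (_ : subset_mx _ _ _ = subset_mx M (A l) (A l)) //.
apply/matrixP => i j; rewrite mxvecK [LHS]mxE [RHS]mxE.
by rewrite extend_subset_mx ?(input_sub (enum_valP _)).
Qed.

Lemma differentiable_transmissions_of : differentiable transmissions_of c0.
Proof.
apply: differentiable_transmissions => //.
apply: differentiable_mulmx; last exact: differentiable_cst.
apply: differentiable_mulmx; first exact: differentiable_cst.
apply: differentiable_vec_mx; apply/differentiable_mxP => i j.
exact: differentiable_coord.
Qed.

(** Moving from [c0] along itself multiplies every column by the same factor 1 + t. *)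
Lemma transmissions_of_scale : c0 *m 'J transmissions_of c0 = 0.
Proof.
rewrite mul_rV_lin1; apply: diff_near_cst.
  exact: differentiable_transmissions_of.
apply: filterS (near0_add1_neq0 R) => t t0.
apply: (transmissions_col_scale (d := fun=> 1 + t)) => // l i j _ _.
rewrite -[X in X + _]scale1r -scalerDl linearZ /=.
by rewrite /extend_mx -scalemxAr -scalemxAl mxE mulrC.
Qed.

(* If j is prescribed in some task, rescaling column j of C_P rescales that
   column in both factors of the transmissions, so v is column j of C_P;
   otherwise the transmissions do not involve column j and any v would do. *)
Lemma transmissions_of_col (j : 'I_p) :
  exists2 v : 'cV[R]_p, v != 0 &
    mxvec (v *m delta_mx 0 j) *m 'J transmissions_of c0 = 0.
Proof.
pose N := vec_mx c0; pose k : 'I_n := enum_val j.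
have [/existsP[l kA]|kA] := boolP [exists l, k \in A l].
  exists (col j N).
    have [i iA Mi] := unit_subset_mx_col_neq0 (uM l) kA.
    apply: contraNneq Mi => /matrixP/(_ (enum_rank_in (input_sub iA) i) 0).
    by rewrite /N mxvecK !mxE enum_rankK_in ?(input_sub iA)// => ->.
  rewrite mul_rV_lin1; apply: diff_near_cst.
    exact: differentiable_transmissions_of.
  apply: filterS (near0_add1_neq0 R) => t t0.
  (* Adding t times column j of C_P in place rescales that column alone. *)
  pose d i := if i == k then 1 + t else 1.
  apply: (transmissions_col_scale (d := d)) => //; rewrite /d.
    by move=> i; case: ifP => _; rewrite ?oner_neq0.
  move=> l' i i' /task_sub iP /input_sub jP.
  rewrite -(enum_rankK_in iP iP) -(enum_rankK_in jP jP) !extend_mxE.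
  rewrite linearD linearZ /= mxvecK !mxE big_ord1 !mxE.
  rewrite (inj_eq enum_val_inj) eqxx /=.
  case: eqP => [->|_]; last by rewrite !mulr0 addr0 mulr1.
  by rewrite mulr1 mulrDr mulr1 mulrC.
exists (delta_mx j 0).
  apply/eqP => /matrixP/(_ j 0); rewrite !mxE !eqxx => /eqP.
  by rewrite oner_eq0.
rewrite mul_rV_lin1; apply: diff_near_cst.
  exact: differentiable_transmissions_of.
apply: filterE => t; apply: eq_transmissions => l i i' /task_sub iP iA.
have jP := input_sub iA.
rewrite -(enum_rankK_in iP iP) -(enum_rankK_in jP jP) !extend_mxE.
have njP : (enum_rank_in jP i' == j) = false.
  apply: contraNF kA => /eqP E; apply/existsP; exists l.
  by rewrite /k -E enum_rankK_in.
by rewrite linearD linearZ /= mxvecK !mxE big_ord1 !mxE njP andbF !mulr0 addr0.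
Qed.

(** C_P contains an invertible block of positive size. Hence the kernel vector given by scaling is
    nonzero. *)
Lemma subset_mx_tasks_neq0 :
  (0 < m)%N -> (forall l, A l != finset.set0) -> subset_mx M P P != 0.
Proof.
move=> m0 A0; pose l := Ordinal m0; have /finset.set0Pn[j jA] := A0 l.
have [i iA Mij] := unit_subset_mx_col_neq0 (uM l) jA.
have iP := input_sub iA; have jP := input_sub jA.
apply: contraNneq Mij => /matrixP/(_ (enum_rank_in iP i) (enum_rank_in jP j)).
by rewrite !mxE !enum_rankK_in // => ->.
Qed.

Lemma mxrank_transmissions_of :
  (\rank ('J transmissions_of c0) <= p * (p - 1))%N.
Proof.
have /fin_all_exists2[v v0 vJ] := transmissions_of_col.
exact: mxrank_col_kernel v0 vJ.
Qed.

End TransmissionRank.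

Arguments transmissions_of {R n m} A B c.

(** * Chain rule, Euler identity and symmetry for a parametrized compliance *)

Section Jacobians.
Context {R : realType} {n m q : nat}.
Variables (A B : 'I_m -> {set 'I_n}) (C : 'rV[R]_q -> 'M[R]_n) (x : 'rV[R]_q).

Let P := (\bigcup_l (A l :|: B l))%SET.

Hypothesis dC : differentiable C x.

Lemma differentiable_mxvec_subset_mx :
  differentiable (fun y => mxvec (subset_mx (C y) P P)) x.
Proof. by apply: differentiable_mxvec; exact: differentiable_mxsub. Qed.

Lemma jacobian_transmissions :
  (forall l, subset_mx (C x) (A l) (A l) \in unitmx) ->
  'J (fun y => transmissions (C y) A B) x =
  'J (fun y => mxvec (subset_mx (C y) P P)) x *m
    'J (transmissions_of A B) (mxvec (subset_mx (C x) P P)).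
Proof.
move=> uC; rewrite -jacobian_comp; last 2 first.
- exact: differentiable_mxvec_subset_mx.
- exact: differentiable_transmissions_of.
by congr ('J _ x); apply/funext => y; rewrite /= transmissions_ofE.
Qed.

(** Euler's identity in degree -1; homogeneity is assumed only along the ray through [x]. *)
Lemma jacobian_euler :
  (forall t : R, 1 + t != 0 -> C (x + t *: x) = (1 + t)^-1 *: C x) ->
  x *m 'J (fun y => mxvec (subset_mx (C y) P P)) x =
  - mxvec (subset_mx (C x) P P).
Proof.
move=> homC; set f := fun y => _.
rewrite -deriveEjacobian; last exact: differentiable_mxvec_subset_mx.
apply: cvg_lim => //.
(* The difference quotient along [x] equals -(1 + t)^-1 times the value at [x]. *)
have cvg1D : ((1 + t) @[t --> (0 : R)^'] --> (1 + 0 : R))%classic.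
  by apply: cvgD; [exact: cvg_cst|exact/cvg_within].
have cvgV1 : ((- (1 + t)^-1 *: f x) @[t --> (0 : R)^'] --> - f x)%classic.
  have -> : - f x = - (1 + 0)^-1 *: f x by rewrite addr0 invr1 scaleN1r.
  by apply: cvgZr_tmp; apply: cvgN; apply: cvgV => //; rewrite addr0 oner_neq0.
apply: cvg_trans cvgV1; apply: near_eq_cvg.
rewrite near_withinE; apply: filterS (near0_add1_neq0 R) => t t0 tN0.
rewrite /f /= [t *: x + x]addrC homC //.
have -> : subset_mx ((1 + t)^-1 *: C x) P P = (1 + t)^-1 *: subset_mx (C x) P P.
  by apply/matrixP => i j; rewrite !mxE.
rewrite linearZ /= -[X in _ - X]scale1r -scalerBl scalerA; congr (_ *: _).
apply: (mulfI tN0); rewrite mulVKf //; apply: (mulIf t0).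
by rewrite mulrN mulNr mulfVK // mulrBl mulVf // mul1r opprD addNKr.
Qed.

(** Each row of [J] is a partial derivative of C_P, whose entries (j, l) and (l, j) are the same
    function. *)
Lemma jacobian_sym :
  (forall y, (C y)^T = C y) -> forall i,
  let J := 'J (fun y => mxvec (subset_mx (C y) P P)) x in
  (vec_mx (row i J))^T = vec_mx (row i J).
Proof.
move=> symC i J; rewrite /J rowE -deriveEjacobian; last first.
  exact: differentiable_mxvec_subset_mx.
rewrite derive_mx; last exact/diff_derivable/differentiable_mxvec_subset_mx.
apply/matrixP => j l; rewrite !mxE.
suff -> : (fun y => mxvec (subset_mx (C y) P P) 0 (mxvec_index l j)) =
    (fun y => mxvec (subset_mx (C y) P P) 0 (mxvec_index j l)) by [].
by apply/funext => y; rewrite !mxvecE !mxE -{1}[C y]symC mxE.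
Qed.

End Jacobians.

(** * Differentiability, homogeneity and symmetry of the compliance *)

Section Compliance.
Context {R : realType} {N nb : nat}.
Variables (x : 'M[R]_(N, 2)) (bond : 'I_nb -> 'I_N * 'I_N).
Variable pinned : {set 'I_(N * 2)}.

(** Taking [k] and [a] as maps covers both variation of k at fixed a and joint variation. *)
Lemma differentiable_compliance (V : normedModType R) (k a : V -> 'rV[R]_nb)
    (y : V) :
  differentiable k y -> differentiable a y ->
  stiffness_ff x bond pinned (k y) (a y) \in unitmx ->
  differentiable (fun z => compliance x bond pinned (k z) (a z)) y.
Proof.
move=> /differentiable_mxP dk /differentiable_mxP da uK.
apply: differentiable_invmx => //; apply: differentiable_mxsub.
apply: differentiable_fct_sum => b; apply: differentiable_mulmx; last first.
  exact: differentiable_cst.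
by apply: differentiableD; apply: differentiableZl.
Qed.

(** K is linear in (k, a) jointly, so its inverse has degree -1. *)
Lemma compliance_scale (k a : 'rV[R]_nb) (c : R) :
  stiffness_ff x bond pinned k a \in unitmx -> c != 0 ->
  compliance x bond pinned (c *: k) (c *: a) =
  c^-1 *: compliance x bond pinned k a.
Proof.
move=> uK c0; rewrite /compliance.
have -> : stiffness_ff x bond pinned (c *: k) (c *: a) =
    c *: stiffness_ff x bond pinned k a.
  rewrite /stiffness_ff; have -> : stiffness x bond (c *: k) (c *: a) =
      c *: stiffness x bond k a.
    rewrite /stiffness scaler_sumr; apply: eq_bigr => b _.
    by rewrite scalemxAl scalerDr !scalerA !mxE.
  by apply/matrixP => i j; rewrite !mxE.
by rewrite invmxZ // unitmxZ // unitfE.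
Qed.

(** At fixed a, changing k adds to K a combination of the symmetric matrices q_b q_b^T. As [invmx]
    is an involution commuting with transposition, symmetry passes between C and K. *)
Lemma compliance_sym (k k' a : 'rV[R]_nb) :
  (compliance x bond pinned k a)^T = compliance x bond pinned k a ->
  (compliance x bond pinned k' a)^T = compliance x bond pinned k' a.
Proof.
rewrite /compliance !trmx_inv => /(can_inj (@invmxK _ _)) symK; congr invmx.
pose S := \sum_b (k' 0 b - k 0 b) *:
  (q_vec x (bond b) *m (q_vec x (bond b))^T).
have symS : S^T = S.
  rewrite raddf_sum /=; apply: eq_bigr => b _.
  by rewrite linearZ /= trmx_mul trmxK.
have SE : stiffness x bond k' a = stiffness x bond k a + S.
  rewrite /stiffness -big_split; apply: eq_bigr => b _ /=.
  by rewrite scalemxAl -mulmxDl addrAC -scalerDl subrKC.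
have -> : stiffness_ff x bond pinned k' a = stiffness_ff x bond pinned k a +
    subset_mx S (~: pinned) (~: pinned).
  by rewrite /stiffness_ff SE; apply/matrixP => i j; rewrite !mxE.
rewrite linearD /= symK; congr (_ + _).
by apply/matrixP => i j; rewrite !mxE -{1}symS mxE.
Qed.

End Compliance.

(** * Assembly of the rank bounds *)

Theorem proposition12 (R : realType) (N nb : nat) (x : 'M[R]_(N, 2))
    (bond : 'I_nb -> 'I_N * 'I_N)
    (length_gt0 : forall b, 0 < bond_length x (bond b))
    (pinned : {set 'I_(N * 2)})
    (card_pinned : #|pinned| = 3%N)
    (pinned_rigid : pins_rigid_modes x pinned)
    (k a : 'rV[R]_nb)
    (k_gt0 : forall b, 0 < k 0 b)
    (Kff_unit : stiffness_ff x bond pinned k a \in unitmx)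
    (m : nat) (m_gt0 : (0 < m)%N)
    (A B : 'I_m -> {set 'I_#|~: pinned|})
    (A_neq0 : forall i, A i != finset.set0)
    (B_neq0 : forall i, B i != finset.set0)
    (AB_disjoint : forall i, [disjoint A i & B i])
    (X_unit : forall i,
       subset_mx (compliance x bond pinned k a) (A i) (A i) \in unitmx) :
  let C := compliance x bond pinned in
  let P := (\bigcup_i (A i :|: B i))%SET in
  let p := #|P| in
  let D (k a : 'rV[R]_nb) := transmissions (C k a) A B in
  let C_P (k a : 'rV[R]_nb) := mxvec (subset_mx (C k a) P P) in
  let dD_dk := 'J (fun k' : 'rV[R]_nb => D k' a) k in
  let dC_P_dk := 'J (fun k' : 'rV[R]_nb => C_P k' a) k in
  let dD_dka :=
    'J (fun ka : 'rV[R]_(nb + nb) => D (lsubmx ka) (rsubmx ka)) (row_mx k a) in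
  (C k a = (C k a)^T ->
     (\rank dD_dk <= minn nb ((p * (p + 1)) %/ 2 - 1))%N /\
     (a = 0 ->
        (\rank dD_dk + 1 <= \rank dC_P_dk <= minn nb ((p * (p + 1)) %/ 2))%N))
  /\ (\rank dD_dka <= minn (2 * nb - 1) (p * (p - 1)))%N.
Proof.
move=> C P p D C_P dD_dk dC_P_dk dD_dka.
have uX l : subset_mx (C k a) (A l) (A l) \in unitmx := X_unit l.
pose c0 : 'rV[R]_(p * p) := C_P k a.
have c0N : c0 != 0 by rewrite mxvec_eq0; exact: subset_mx_tasks_neq0.
have c0L : c0 *m 'J (transmissions_of A B) c0 = 0.
  exact: transmissions_of_scale.
have id_diff (q : nat) (y : 'rV[R]_q) : differentiable (fun z => z) y.
  by apply/differentiable_mxP => i j; exact: differentiable_coord.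
split.
  move=> symC.
  have dC : differentiable (fun k' => C k' a) k.
    by apply: differentiable_compliance => //; exact: differentiable_cst.
  have JD : dD_dk = dC_P_dk *m 'J (transmissions_of A B) c0.
    exact: (jacobian_transmissions B dC uX).
  have symJ i : (vec_mx (row i dC_P_dk))^T = vec_mx (row i dC_P_dk).
    apply: (jacobian_sym A B dC) => k'.
    by apply: (@compliance_sym _ _ _ _ _ _ k); rewrite -symC.
  split.
    rewrite leq_min rank_leq_row JD.
    apply: (mxrank_mulmx_sym symJ (M := subset_mx (C k a) P P)) => //.
      by rewrite -mxvec_eq0.
    by apply/matrixP => i j; rewrite !mxE [in RHS]symC mxE.
  move=> a0; rewrite leq_min rank_leq_row mxrank_sym // !andbT.
  have euler : k *m dC_P_dk = - c0.
    apply: (jacobian_euler A B dC) => t t0.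
    rewrite -(compliance_scale Kff_unit) // scalerDl scale1r.
    by rewrite a0 scaler0.
  rewrite JD.
  (* By Euler, the kernel vector [c0] is the image of -k under [dC_P_dk], so it lies in the row
     space. *)
  apply: mxrank_mulmx_le c0N _ c0L.
  by rewrite -[c0]opprK -euler -mulNmx submxMl.
have dC : differentiable (fun ka => C (lsubmx ka) (rsubmx ka)) (row_mx k a).
  apply: differentiable_compliance; rewrite ?row_mxKl ?row_mxKr //.
    exact: differentiable_lsubmx.
  exact: differentiable_rsubmx.
have uX' l : subset_mx (C (lsubmx (row_mx k a)) (rsubmx (row_mx k a)))
    (A l) (A l) \in unitmx.
  by rewrite row_mxKl row_mxKr.
have JD := jacobian_transmissions B dC uX'.
have c0E : C_P (lsubmx (row_mx k a)) (rsubmx (row_mx k a)) = c0.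
  by rewrite row_mxKl row_mxKr.
rewrite -/(C_P _ _) c0E in JD.
rewrite leq_min; apply/andP; split.
  have euler : row_mx k a *m
      'J (fun ka => C_P (lsubmx ka) (rsubmx ka)) (row_mx k a) = - c0.
    rewrite -[in RHS]c0E; apply: (jacobian_euler A B dC) => t t0.
    have -> : row_mx k a + t *: row_mx k a =
        row_mx ((1 + t) *: k) ((1 + t) *: a).
      by rewrite -scale_row_mx scalerDl scale1r.
    by rewrite !row_mxKl !row_mxKr; exact: compliance_scale.
  (* Its image under the Jacobian of C_P is -[c0], which is nonzero. *)
  have kaN0 : row_mx k a != 0.
    by apply: contraNneq c0N => ka0; rewrite -oppr_eq0 -euler ka0 mul0mx.
  have kaJ : row_mx k a *m dD_dka = 0.
    by rewrite /dD_dka JD mulmxA euler mulNmx c0L oppr0.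
  (* Taking the identity as left factor, the kernel vector (k, a) lowers the rank below 2 [nb]. *)
  have := mxrank_mulmx_le kaN0 (submx1 _) kaJ.
  rewrite mul1mx mxrank1 addn1 mul2n -addnn => lt.
  by rewrite subn1 -ltnS (ltn_predK lt).
(* The second bound is the rank of the right factor alone, whatever the parametrization of C_P. *)
rewrite /dD_dka JD; apply: leq_trans (mxrankM_maxr _ _) _.
exact: mxrank_transmissions_of.
Qed.
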